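(* For every instance of the block relocation problem (BRP), Algorithm IS terminates after a finite number of iterations and returns an optimal solution of the BRP, i.e. a feasible move sequence with the minimum number of relocations.
   Context: Setting (BRP). There are $S$ stacks and $B$ blocks labelled $1,\dots,B$; a smaller label means a higher priority. A configuration places blocks in the stacks, each stack being a finite vertical sequence of blocks; the initial configuration $\mathbb{C}$ contains every block exactly once. Stacks have a height limit $H$ (at most $H$ blocks per stack; $H=\infty$ if there is no limit). A relocation takes the topmost block of a stack and puts it on top of a different stack (respecting the height limit). A retrieval removes the block of smallest label among those still present, and is allowed only if it is topmost in its stack. A feasible move sequence is a finite sequence of relocations and retrievals starting from $\mathbb{C}$ after which all blocks have been retrieved; at least one is assumed to exist. No block is directly retrievable in $\mathbb{C}$ (block $1$ is not topmost). The BRP asks for a feasible move sequence with the least number of relocations. A lower bound of the BRP is an integer not exceeding this least number. A direct blockage in a configuration is a pair of blocks such that one lies directly on top of the other in the same stack and the upper one has lower priority (larger label). Relaxed problem with parameter $L$ (where $L$ is a lower bound of the BRP): determine a sequence of moves starting from $\mathbb{C}$ so that, after its first $L$ relocations and all applicable retrieval moves, the sum of $L$ and the number of direct blockages in the resulting configuration is minimized. BRP-m3R with parameter $L$ denotes an exact mixed integer programming formulation of this relaxed problem; its optimal value is the minimum of that sum and its optimal solutions are the minimizing sequences. When the resulting configuration has no direct blockage, the remaining blocks can be retrieved without relocation, and the sequence is identified with its completion by these retrievals. Algorithm IS: (1) set $L\leftarrow 0$ and $L'\leftarrow$ a (positive) lower bound of the BRP. (2) While $L<L'$: set $L\leftarrow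 L'$; solve BRP-m3R with parameter $L$ to optimality; set $L'\leftarrow$ its optimal value. (3) Return an optimal solution of the last solved BRP-m3R. One pass of the loop is an iteration. *)

(* Defs.v *)
From mathcomp Require Import all_boot.

Set Implicit Arguments.
Unset Strict Implicit.
Unset Printing Implicit Defensive.

(* A block is its label, and the head of a stack is its topmost block. *)
Definition config (ns : nat) := {ffun 'I_ns -> seq nat}.

Inductive move (ns : nat) : Type :=
  | Relocate of 'I_ns & 'I_ns
  | Retrieve of 'I_ns.

Arguments Relocate {ns}.
Arguments Retrieve {ns}.

Definition is_relocation ns (m : move ns) : bool :=
  if m is Relocate _ _ then true else false.

Definition nrelocations ns (s : seq (move ns)) : nat :=
  count (@is_relocation ns) s.

(* [None] is the absence of a height limit. *)
Definition within_limit (H : option nat) (n : nat) : bool :=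
  if H is Some h then n <= h else true.

Definition set_stack ns (D : config ns) (i : 'I_ns) (s : seq nat) : config ns :=
  [ffun k => if k == i then s else D k].

(* [None] means that the move is not allowed. *)
Definition apply_move ns (H : option nat) (D : config ns) (m : move ns)
    : option (config ns) :=
  match m with
  | Relocate i j =>
      if D i is b :: t then
        if (i != j) && within_limit H (size (D j)).+1
        then Some (set_stack (set_stack D i t) j (b :: D j))
        else None
      else None
  | Retrieve i =>
      if D i is b :: t then
        if [forall j, all (leq b) (D j)] then Some (set_stack D i t) else None
      else None
  end.

Fixpoint apply_moves ns (H : option nat) (D : config ns) (s : seq (move ns))
    : option (config ns) :=
  if s is m :: s' then
    if apply_move H D m is Some D' then apply_moves H D' s' else None
  else Some D.

Definition no_retrieval ns (H : option nat) (D : config ns) : Prop :=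
  forall i, apply_move H D (Retrieve i) = None.

Definition feasible ns (H : option nat) (C : config ns) (s : seq (move ns))
    : Prop :=
  exists2 D, apply_moves H C s = Some D & forall i, D i = [::].

Record BRP_instance ns (H : option nat) (B : nat) (C : config ns) : Prop := {
  BRP_blocks : perm_eq (flatten [seq C i | i <- enum 'I_ns]) (iota 1 B);
  BRP_heights : forall i, within_limit H (size (C i));
  BRP_no_retrieval : no_retrieval H C;
  BRP_feasible : exists s, feasible H C s
}.

Definition BRP_optimal ns (H : option nat) (C : config ns) (s : seq (move ns))
    : Prop :=
  feasible H C s /\
  forall s', feasible H C s' -> nrelocations s <= nrelocations s'.

Definition BRP_lower_bound ns (H : option nat) (C : config ns) (L : nat)
    : Prop :=
  exists2 s, BRP_optimal H C s & L <= nrelocations s.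

Definition stack_blockages (s : seq nat) : nat :=
  count (fun p => p.2 < p.1) (zip s (behead s)).

Definition direct_blockages ns (D : config ns) : nat :=
  \sum_(i < ns) stack_blockages (D i).

(* [s] consists of exactly [L] relocations, interleaved with retrievals, and
   leads to [D], where every applicable retrieval has been carried out. *)
Definition m3R_solution ns (H : option nat) (C : config ns) (L : nat)
    (s : seq (move ns)) (D : config ns) : Prop :=
  [/\ nrelocations s = L, apply_moves H C s = Some D & no_retrieval H D].

Definition m3R_optimal ns (H : option nat) (C : config ns) (L : nat)
    (s : seq (move ns)) (v : nat) : Prop :=
  exists D, [/\ m3R_solution H C L s D, v = L + direct_blockages D &
    forall s' D', m3R_solution H C L s' D' -> v <= L + direct_blockages D'].

(* [IS_sol] is the solution found for the last solved BRP-m3R, if any. *)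
Record IS_state (ns : nat) : Type := IS_State {
  IS_L : nat;
  IS_L' : nat;
  IS_sol : option (seq (move ns))
}.

Definition IS_init ns (H : option nat) (C : config ns) (st : IS_state ns)
    : Prop :=
  [/\ IS_L st = 0, 0 < IS_L' st, BRP_lower_bound H C (IS_L' st)
    & IS_sol st = None].

Definition IS_continue ns (st : IS_state ns) : bool := IS_L st < IS_L' st.

(* The lower bound in [IS_init] and the optimal solution chosen here are
   arbitrary, so the algorithm is a nondeterministic transition system. *)
Definition IS_iteration ns (H : option nat) (C : config ns)
    (st st' : IS_state ns) : Prop :=
  [/\ IS_continue st, IS_L st' = IS_L' st &
    exists2 s, IS_sol st' = Some s & m3R_optimal H C (IS_L st') s (IS_L' st')].

Inductive IS_reachable ns (H : option nat) (C : config ns)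
    : IS_state ns -> Prop :=
  | IS_reachable_init st : IS_init H C st -> IS_reachable H C st
  | IS_reachable_iteration st st' :
      IS_reachable H C st -> IS_iteration H C st st' -> IS_reachable H C st'.

(* Main.v *)
Require Import Defs.
From mathcomp Require Import all_boot.
From mathcomp Require Import zify.
From Stdlib Require Import Classical_Prop.

Set Implicit Arguments.
Unset Strict Implicit.
Unset Printing Implicit Defensive.

(** A relocation lowers the number of direct blockages by at most one, and a
    retrieval leaves it unchanged. Hence, after the first [L] relocations of an
    optimal sequence with [N >= L] relocations, at most [N - L] direct blockages
    remain, even once all applicable retrievals are carried out, so the optimal
    value of BRP-m3R with parameter [L] is again a lower bound of the BRP. The
    bounds increase strictly while the loop runs and never exceed [N], which
    gives termination. On exit no direct blockage is left; the stacks are then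
    sorted, so the smallest block present would be retrievable, and since no
    retrieval applies the configuration is empty. *)

(** Strong induction on [f x]. Since [P] need not be decidable, excluded middle settles whether a
    smaller value occurs. *)
Lemma ex_minimizer {T : Type} (P : T -> Prop) (f : T -> nat) :
  (exists x, P x) -> exists2 x, P x & forall y, P y -> f x <= f y.
Proof.
case=> x; have [n] := ubnP (f x); elim: n x => // n IHn x fx_lt Px.
have [[y [Py fy_lt]]|no_smaller] := classic (exists y, P y /\ f y < f x).
  by apply: (IHn y) => //; lia.
exists x => // y Py; rewrite leqNgt; apply/negP => fy_lt.
by apply: no_smaller; exists y.
Qed.

Section Moves.

Context {ns : nat} (H : option nat).
Implicit Types (D : config ns) (s : seq (move ns)).

(** The term lost is added on one side and the term gained on the other, which avoids truncated
    subtraction. *)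
Lemma sum_set_stack (f : seq nat -> nat) D i t :
  \sum_k f (set_stack D i t k) + f (D i) = \sum_k f (D k) + f t.
Proof.
rewrite (bigD1 i) //= [X in _ = X + _](bigD1 i) //= ffunE eqxx.
have -> : \sum_(k | k != i) f (set_stack D i t k) = \sum_(k | k != i) f (D k).
  by apply: eq_bigr => k /negPf k_i; rewrite ffunE k_i.
by rewrite addnAC [RHS]addnAC [f t + _]addnC.
Qed.

Lemma stack_blockages_cons b t :
  stack_blockages (b :: t) =
    (if t is c :: _ then c < b else false) + stack_blockages t.
Proof. by case: t. Qed.

Lemma stack_blockages_eq0 t : (stack_blockages t == 0) = sorted leq t.
Proof.
elim: t => // b [|c t] //= IHt.
by rewrite stack_blockages_cons addn_eq0 IHt eqb0 -leqNgt.
Qed.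

Lemma apply_moves_cat D s1 s2 :
  apply_moves H D (s1 ++ s2) =
    if apply_moves H D s1 is Some D' then apply_moves H D' s2 else None.
Proof. by elim: s1 D => //= m s IHs D; case: (apply_move H D m). Qed.

(** A retrieved block has the smallest label present, so it does not block the one beneath it. *)
Lemma retrieve_blockages D i D' : apply_move H D (Retrieve i) = Some D' ->
  direct_blockages D' = direct_blockages D.
Proof.
rewrite /=; case Di: (D i) => [|b t] //; case: ifP => // /forallP/(_ i).
rewrite Di => /andP[_ b_min] [<-]; apply/eqP.
rewrite -(eqn_add2r (stack_blockages (D i))) sum_set_stack; apply/eqP.
rewrite Di stack_blockages_cons; case: t b_min {Di} => //= c t /andP[b_c _].
by rewrite ltnNge b_c.
Qed.

Lemma retrieve_size D i D' : apply_move H D (Retrieve i) = Some D' ->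
  \sum_k size (D' k) < \sum_k size (D k).
Proof.
rewrite /=; case Di: (D i) => [|b t] //; case: ifP => // _ [<-].
by have := sum_set_stack size D i t; rewrite Di /=; lia.
Qed.

(** Lifting a block removes at most the blockage between it and the block below, and putting it down
    removes none. *)
Lemma apply_move_blockages D m D' : apply_move H D m = Some D' ->
  direct_blockages D <= is_relocation m + direct_blockages D'.
Proof.
case: m => [i j|i]; last by move/retrieve_blockages->.
rewrite /=; case Di: (D i) => [|b t] //; case: ifP => // /andP[i_j _] [<-].
have := sum_set_stack stack_blockages D i t.
have := sum_set_stack stack_blockages (set_stack D i t) j (b :: D j).
rewrite /direct_blockages Di ffunE eq_sym (negPf i_j) !stack_blockages_cons.
by case: (t) => [|c t'] /=; case: (D j) => [|d u] /=; lia.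
Qed.

Lemma apply_moves_blockages D s D' : apply_moves H D s = Some D' ->
  direct_blockages D <= nrelocations s + direct_blockages D'.
Proof.
elim: s D => [D [->] //|m s IHs D] /=.
case Dm: (apply_move H D m) => [E|] // /IHs.
by have := apply_move_blockages Dm; rewrite /nrelocations /=; lia.
Qed.

Lemma empty_blockages D : (forall i, D i = [::]) -> direct_blockages D = 0.
Proof. by move=> D0; apply: big1 => i _; rewrite D0. Qed.

Lemma exhaust_retrievals D : exists s D',
  [/\ nrelocations s = 0, apply_moves H D s = Some D', no_retrieval H D'
    & direct_blockages D' = direct_blockages D].
Proof.
have [n] := ubnP (\sum_k size (D k)); elim: n D => // n IHn D szD.
have [/existsP[i]|/existsPn stuck] :=
  boolP [exists i, isSome (apply_move H D (Retrieve i))].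
  case Di: (apply_move H D (Retrieve i)) => [E|] // _.
  have [|s [D' [s0 Es D'stuck D'E]]] := IHn E.
    by have := retrieve_size Di; lia.
  exists (Retrieve i :: s), D'; split=> //; last first.
    by rewrite D'E (retrieve_blockages Di).
  by move: Di => /= ->.
exists [::], D; split=> // i; have := stuck i.
by case: (apply_move H D (Retrieve i)).
Qed.

Lemma prefix_nrelocations s L : L <= nrelocations s ->
  exists s1 s2, s = s1 ++ s2 /\ nrelocations s1 = L.
Proof.
elim: s L => [|m s IHs] L.
  by rewrite leqn0 => /eqP->; exists [::], [::].
case: L => [_|L le_L]; first by exists [::], (m :: s).
(* The tail must supply the relocations that [m] does not; the target is positive here, so the
   subtraction is exact. *)
have [|s1 [s2 [-> s1L]]] := IHs (L.+1 - is_relocation m).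
  by move: le_L; rewrite /nrelocations /=; lia.
exists (m :: s1), s2; split=> //.
by move: s1L; rewrite /nrelocations /=; case: (is_relocation m) => /=; lia.
Qed.

Lemma no_retrieval_no_blockage D :
  no_retrieval H D -> direct_blockages D = 0 -> forall i, D i = [::].
Proof.
move=> stuck /eqP; rewrite sum_nat_eq0 => /forallP/= D0 i0.
apply/eqP/negPn/negP => Di0.
(* Take the nonempty stack with the smallest top block. Every stack increases downwards, so this
   block is the smallest of all and retrievable. The default [0] is never compared, as [P] excludes
   empty stacks. *)
case: (arg_minnP (P := fun i => D i != [::]) (fun i => head 0 (D i)) Di0).
move=> i Di i_min; have := stuck i; rewrite /=.
case Ei: (D i) Di => [|b t] // _; case: ifP => // /negP; case.
apply/forallP => j; case Ej: (D j) => [|c u] //.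
have b_c : b <= c by have := i_min j; rewrite Ei Ej; apply.
have := D0 j; rewrite stack_blockages_eq0 Ej /= => c_u.
rewrite /= b_c; have /allP c_min := order_path_min leq_trans c_u.
by apply/allP => x /c_min; apply: leq_trans.
Qed.

End Moves.

Section Algorithm.

Context {ns : nat} (H : option nat) (C : config ns).

Lemma ex_BRP_optimal : (exists s, feasible H C s) -> exists s, BRP_optimal H C s.
Proof. by case/(ex_minimizer (@nrelocations ns)) => s; exists s. Qed.

Lemma BRP_lower_boundP L :
  BRP_lower_bound H C L -> forall s, feasible H C s -> L <= nrelocations s.
Proof. by case=> s0 [_ s0min] L_s0 s /s0min; apply: leq_trans. Qed.

Lemma ex_m3R_solution L s : feasible H C s -> L <= nrelocations s ->
  exists s' D, m3R_solution H C L s' D /\ L + direct_blockages D <= nrelocations s.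
Proof.
move=> [E Cs E0] /prefix_nrelocations[s1 [s2 [def_s s1L]]]; move: Cs.
rewrite def_s apply_moves_cat; case Cs1: (apply_moves H C s1) => [D1|] // D1s2.
have [r [D [r0 D1r Dstuck DE]]] := exhaust_retrievals H D1.
exists (s1 ++ r), D; split.
  split=> //; last by rewrite apply_moves_cat Cs1.
  by move: r0 s1L; rewrite /nrelocations count_cat; lia.
(* The remaining moves [s2] clear every blockage of [D1], and the retrievals [r] leave their number
   unchanged. *)
have := apply_moves_blockages D1s2; rewrite (empty_blockages E0) DE.
by move: s1L; rewrite /nrelocations count_cat; lia.
Qed.

Lemma ex_m3R_optimal L :
  BRP_lower_bound H C L -> exists s v, m3R_optimal H C L s v.
Proof.
case=> s0 [s0f _] /(ex_m3R_solution s0f)[s [D [sD _]]].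
pose P x := m3R_solution H C L x.1 x.2.
have [|[s' D'] s'D' D'min] :=
  @ex_minimizer (seq (move ns) * config ns) P (fun x => direct_blockages x.2).
  by exists (s, D).
exists s', (L + direct_blockages D'), D'; split=> // s'' D'' s''D''.
by rewrite leq_add2l; apply: (D'min (s'', D'')).
Qed.

Lemma m3R_optimal_lower_bound L s v :
  BRP_lower_bound H C L -> m3R_optimal H C L s v -> BRP_lower_bound H C v.
Proof.
case=> s0 [s0f s0min] /(ex_m3R_solution s0f)[s1 [D1 [s1D1 le_s0]]].
case=> D [_ _ vmin]; exists s0 => //.
by apply: leq_trans le_s0; apply: vmin s1D1.
Qed.

(** Value equal to parameter means that no blockage is left, so [s] empties the stacks with exactly
    [L] relocations, which is a lower bound. *)
Lemma m3R_optimal_BRP_optimal L s :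
  BRP_lower_bound H C L -> m3R_optimal H C L s L -> BRP_optimal H C s.
Proof.
move=> lbL [D [[sL Cs Dstuck] LD _]]; split; last first.
  by move=> s' /(BRP_lower_boundP lbL); rewrite sL.
by exists D => //; apply: no_retrieval_no_blockage Dstuck _; lia.
Qed.

Lemma IS_iteration_lower_bound st st' : IS_iteration H C st st' ->
  BRP_lower_bound H C (IS_L' st) -> BRP_lower_bound H C (IS_L' st').
Proof.
by case=> _ -> [s _ s_opt] lb; apply: m3R_optimal_lower_bound lb s_opt.
Qed.

Lemma IS_reachable_lower_bound st :
  IS_reachable H C st -> BRP_lower_bound H C (IS_L' st).
Proof.
by elim=> {st} [st []|st st' _ lb /IS_iteration_lower_bound]; [|apply].
Qed.

Lemma IS_terminates (run : nat -> IS_state ns) : IS_init H C (run 0) ->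
  ~ (forall n, IS_iteration H C (run n) (run n.+1)).
Proof.
case=> _ _ lb0 _ run_iter.
have lb n : BRP_lower_bound H C (IS_L' (run n)).
  by elim: n => // n; apply: IS_iteration_lower_bound.
have n_L n : n <= IS_L (run n).
  elim: n => // n IHn; have [cont -> _] := run_iter n.
  exact: leq_ltn_trans IHn cont.
(* In state [run N] the loop condition yields [N <= IS_L < IS_L'], whereas the lower bound yields
   [IS_L' <= N]. *)
have [s [s_f _] _] := lb0; set N := nrelocations s.
have [cont _ _] := run_iter N; have := BRP_lower_boundP (lb N) s_f.
by have := n_L N; move: cont; rewrite /IS_continue -/N; lia.
Qed.

Lemma IS_exit_optimal st : IS_reachable H C st -> ~~ IS_continue st ->
  exists2 s, IS_sol st = Some s & BRP_optimal H C s.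
Proof.
(* The loop cannot exit at an initial state, because the first bound is positive. *)
case=> {}st; first by case=> L0 L'_gt0 _ _; rewrite /IS_continue L0 L'_gt0.
move=> st' st_reach [_ L_L' [s sol_s s_opt]]; rewrite /IS_continue -leqNgt => le_L.
exists s => //; have lb := IS_reachable_lower_bound st_reach.
(* The optimal value is at least its parameter; the exit condition gives the converse. *)
have L'E : IS_L' st' = IS_L st' by case: s_opt => D [_ vE _]; lia.
by rewrite L'E L_L' in s_opt; apply: m3R_optimal_BRP_optimal lb s_opt.
Qed.

Lemma no_retrieval_nrelocations_gt0 s :
  no_retrieval H C -> (exists i, C i != [::]) -> feasible H C s ->
  0 < nrelocations s.
Proof.
move=> stuck [i Ci] [D]; case: s => [[<-] C0|[j k|j] s]; rewrite ?/nrelocations //=.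
  by rewrite C0 in Ci.
by have := stuck j; rewrite /= => ->.
Qed.

End Algorithm.

Theorem theorem8 (ns B : nat) (H : option nat) (C : config ns)
    (hC : BRP_instance H B C) :
  [/\ (* the initialization is possible *)
      0 < B -> exists st, IS_init H C st,
      (* no execution performs infinitely many iterations *)
      forall run : nat -> IS_state ns, IS_init H C (run 0) ->
        ~ (forall n, IS_iteration H C (run n) (run n.+1)),
      (* as long as the loop condition holds, an iteration can be performed *)
      forall st, IS_reachable H C st -> IS_continue st ->
        exists st', IS_iteration H C st st'
    & (* on exit, the returned sequence is an optimal solution of the BRP *)
      forall st, IS_reachable H C st -> ~~ IS_continue st ->
        exists2 s, IS_sol st = Some s & BRP_optimal H C s].
Proof.
case: hC => blocks _ stuck feas; split.
(* The bound [1] is valid: block [1] is present and nothing is retrievable, so any feasible sequence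
   starts with a relocation. *)
- move=> B_gt0; exists (IS_State 0 1 None); split=> //.
  have [s s_opt] := ex_BRP_optimal feas; exists s => //.
  apply: no_retrieval_nrelocations_gt0 stuck _ s_opt.1.
  have : 1 \in flatten [seq C i | i <- enum 'I_ns].
    by rewrite (perm_mem blocks) mem_iota /=; lia.
  by case/flatten_mapP => i _ Ci; exists i; case: (C i) Ci.
- exact: IS_terminates.
- move=> st /IS_reachable_lower_bound/ex_m3R_optimal[s [v s_opt]] cont.
  by exists (IS_State (IS_L' st) v (Some s)); split=> //; exists s.
- exact: IS_exit_optimal.
Qed.
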